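(* Let $\mathfrak{g}$ be a unimodular integrable LCK Lie algebra. Then $\mathfrak{g}$ is solvable.
   Context: Lie algebras are real and finite-dimensional; for $\alpha\in\mathfrak{g}^*$ the Chevalley-Eilenberg differential satisfies $d\alpha(X,Y)=-\alpha([X,Y])$, and for a $2$-form $\Omega$, $d\Omega(X,Y,Z)=-\Omega([X,Y],Z)-\Omega([Y,Z],X)-\Omega([Z,X],Y)$. An LCK structure on a Lie algebra $\mathfrak{g}$ of dimension $2n+2$ ($n\ge1$) consists of a positive definite inner product $g$, an endomorphism $J$ with $J^2=-\mathrm{Id}$ and $N_J(X,Y)=[JX,JY]-[X,Y]-J[JX,Y]-J[X,JY]=0$ for all $X,Y$, such that $\Omega(X,Y)=g(X,JY)$ is a $2$-form, and $1$-forms $\theta,\eta\in\mathfrak g^*$ with $d\Omega=\theta\wedge\Omega$, $d\theta=0$, and $\eta(X)=-\theta(JX)$. By rescaling the metric it is always assumed that $|\theta|=1$. The LCK Lie algebra is integrable if $\eta\wedge d\eta=0$. A Lie algebra is unimodular if $\mathrm{tr}(\mathrm{ad}_X)=0$ for all $X$. *)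

(* Defs.v *)
From HB Require Import structures.
From mathcomp Require Import all_boot all_order all_algebra.
From mathcomp Require Import reals.

Set Implicit Arguments.
Unset Strict Implicit.
Unset Printing Implicit Defensive.

Import Order.TTheory GRing.Theory Num.Theory.
Local Open Scope ring_scope.

HB.mixin Record Vector_isLieAlgebra (F : fieldType) L of Vector F L := {
  lie : L -> L -> L;
  lie_linearl : forall Y, linear (lie^~ Y);
  lie_linearr : forall X, linear (lie X);
  liexx : forall X, lie X X = 0;
  lie_jacobi : forall X Y Z,
    lie X (lie Y Z) + lie Y (lie Z X) + lie Z (lie X Y) = 0
}.

#[short(type="lieAlgType")]
HB.structure Definition LieAlgebra (F : fieldType) :=
  {L of Vector F L & Vector_isLieAlgebra F L}.

Notation "[< X , Y >]" := (lie X Y)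
  (at level 0, X at level 99, Y at level 99, format "[<  X ,  Y  >]")
  : ring_scope.

Section LieAlgebraTheory.
Context {F : fieldType} {L : lieAlgType F}.
Implicit Types (X Y : L) (U V W : {vspace L}).

Lemma lie_is_bilinear : bilinear_for
  (GRing.Scale.Law.clone _ _ *:%R _) (GRing.Scale.Law.clone _ _ *:%R _)
  (@lie F L).
Proof. by split=> [Y | X]; [apply: lie_linearl | apply: lie_linearr]. Qed.

HB.instance Definition _ :=
  bilinear_isBilinear.Build F L L L _ _ (@lie F L) lie_is_bilinear.

HB.instance Definition _ X :=
  GRing.isLinear.Build F L L _ (lie X) (lie_linearr X).

Definition ad X : 'End(L) := linfun (lie X).

Lemma adE X Y : ad X Y = [< X, Y >].
Proof. by rewrite /ad lfunE. Qed.

Definition lfun_trace (f : 'End(L)) : F :=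
  \tr (passmx.mxof (vbasis {:L}) (vbasis {:L}) f).

Lemma lfun_traceE (e : (\dim {:L}).-tuple L) (f : 'End(L)) :
  basis_of {:L} e -> lfun_trace f = \tr (passmx.mxof e e f).
Proof.
move=> eB; have bB := vbasisP {:L}; rewrite /lfun_trace.
set b := vbasis _ in bB *.
have -> : passmx.mxof b b f =
    passmx.mxof b e \1%VF *m passmx.mxof e e f *m passmx.mxof e b \1%VF.
  by rewrite -!passmx.mxof_comp // comp_lfun1l comp_lfun1r.
rewrite mxtrace_mulC mulmxA -passmx.mxof_comp // comp_lfun1l.
by rewrite passmx.mxof1 ?mul1mx // (basis_free eB).
Qed.

Definition unimodular : Prop := forall X, lfun_trace (ad X) = 0.

(* The subspace spanned by all brackets [< u, v >] with u in U and v in V;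
   bilinearity makes a basis of each sufficient, see lie_spaceP. *)
Definition lie_space U V : {vspace L} :=
  <<[seq [< u, v >] | u <- vbasis U, v <- vbasis V]>>%VS.

Lemma memv_lie U V X Y : X \in U -> Y \in V -> [< X, Y >] \in lie_space U V.
Proof.
move=> /coord_vbasis -> /coord_vbasis ->.
rewrite linear_sumlz rpred_sum // => i _; rewrite linear_sumr rpred_sum // => j _.
rewrite linearZl_LR linearZr_LR !rpredZ // memv_span //.
by apply/allpairsP; exists ((vbasis U)`_i, (vbasis V)`_j);
  rewrite /= !mem_nth ?size_tuple.
Qed.

Lemma lie_spaceP U V W :
  reflect (forall X Y, X \in U -> Y \in V -> [< X, Y >] \in W)
          (lie_space U V <= W)%VS.
Proof.
apply: (iffP idP) => [sUVW X Y XU YV | UVW].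
  by apply: (subvP sUVW); apply: memv_lie.
by apply/span_subvP=> _ /allpairsP[[u v] /= [uU vV ->]];
  apply: UVW; apply: vbasis_mem.
Qed.

Fixpoint derived_series (k : nat) : {vspace L} :=
  if k is k'.+1 then lie_space (derived_series k') (derived_series k') else fullv.

Definition lie_solvable : Prop := exists k, derived_series k = 0%VS.

End LieAlgebraTheory.

Arguments unimodular {F} L.
Arguments lie_solvable {F} L.

Section Forms.
Context {F : fieldType} {L : lieAlgType F}.
Implicit Types (alpha : 'Hom(L, F^o)) (omega : L -> L -> F).

Definition alternating omega : Prop := forall X, omega X X = 0.

Definition d1 alpha (X Y : L) : F := - (alpha [< X, Y >] : F).

Definition d2 omega (X Y Z : L) : F :=
  - omega [< X, Y >] Z - omega [< Y, Z >] X - omega [< Z, X >] Y.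

(* The sum over (1,2)-shuffles, without numerical factor: this is the
   normalisation of the wedge product which goes with d1 and d2. *)
Definition wedge12 alpha omega (X Y Z : L) : F :=
  (alpha X : F) * omega Y Z + (alpha Y : F) * omega Z X
  + (alpha Z : F) * omega X Y.

Definition nijenhuis (J : 'End(L)) (X Y : L) : L :=
  [< J X, J Y >] - [< X, Y >] - J [< J X, Y >] - J [< X, J Y >].

End Forms.

Section CoNorm.
Context {R : realType} {V : vectType R} (g : {dot V for idfun}).

Definition flat : 'Hom(V, 'Hom(V, R^o)) :=
  linfun (fun X => linfun (g X : V -> R^o)).

Definition sharp : 'Hom('Hom(V, R^o), V) := (flat^-1)%VF.

Definition conorm (alpha : 'Hom(V, R^o)) : R :=
  Num.sqrt (g (sharp alpha) (sharp alpha)).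

Lemma g_linearr X : linear (g X : V -> R^o).
Proof. by move=> a Y Z; rewrite linearPr. Qed.

Lemma flatE X Y : flat X Y = g X Y.
Proof.
have gE Z T : linfun (g Z : V -> R^o) T = g Z T.
  pose h := GRing.isLinear.Build R V R^o _ (g Z : V -> R^o) (g_linearr Z).
  pose G : {linear V -> R^o} := HB.pack (g Z : V -> R^o) h.
  exact: (lfunE G).
have flat_lin : linear (fun Z => linfun (g Z : V -> R^o)).
  move=> a Z T; apply/lfunP=> W.
  by rewrite add_lfunE scale_lfunE !gE linearPl.
pose h := GRing.isLinear.Build R V _ _ _ flat_lin.
pose G : {linear V -> 'Hom(V, R^o)} :=
  HB.pack (fun Z => linfun (g Z : V -> R^o)) h.
by rewrite /flat (lfunE G) /= gE.
Qed.

Lemma lker_flat : lker flat == 0%VS.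
Proof.
apply/lker0P=> X Y eXY; apply/eqP; rewrite -subr_eq0; apply/eqP.
have gXY : g (X - Y) (X - Y) = 0.
  by rewrite linearBl /= -!flatE eXY subrr.
apply: contra_eq gXY => nzXY.
by rewrite lt0r_neq0 ?neq0_dnorm_gt0.
Qed.

(* The vector sharp alpha is the metric dual of alpha, and conorm is the
   norm which g induces on the dual space. *)
Lemma sharpP alpha X : g (sharp alpha) X = alpha X.
Proof.
rewrite -flatE /sharp; suff /(limg_lfunVK) -> : alpha \in limg flat by [].
suff -> : limg flat = fullv by apply: memvf.
apply/eqP; rewrite eqEdim subvf /=.
rewrite limg_dim_eq ?(eqP lker_flat) ?capv0 //.
by rewrite !dimvf /dim /= muln1.
Qed.

End CoNorm.

Record lck_structure (R : realType) (L : lieAlgType R) := LCKStructure {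
  lck_g : {dot L for idfun};
  lck_J : 'End(L);
  lck_theta : 'Hom(L, R^o);
  lck_eta : 'Hom(L, R^o);
  lck_Omega (X Y : L) : R := lck_g X (lck_J Y);
  lck_J2 : (lck_J \o lck_J)%VF = - \1%VF;
  lck_JN : forall X Y, nijenhuis lck_J X Y = 0;
  lck_Omega_alt : alternating lck_Omega;
  lck_dOmega : forall X Y Z,
    d2 lck_Omega X Y Z = wedge12 lck_theta lck_Omega X Y Z;
  lck_dtheta : forall X Y, d1 lck_theta X Y = 0;
  lck_etaE : forall X, lck_eta X = - lck_theta (lck_J X);
  lck_theta_norm : conorm lck_g lck_theta = 1
}.

Definition lck_integrable (R : realType) (L : lieAlgType R)
    (S : lck_structure L) : Prop :=
  forall X Y Z, wedge12 (lck_eta S) (d1 (lck_eta S)) X Y Z = 0.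

(* Main.v *)
From HB Require Import structures.
Require Import Defs.
From mathcomp Require Import all_boot all_order all_algebra.
From mathcomp Require Import reals.
From mathcomp Require Import lra.

(** Let h be the common kernel of theta and eta, A the unit vector dual to theta,
    and B = J A.  Integrability makes the kernel of eta a subalgebra, and then
    the Nijenhuis condition on A and an element of h gives eta [B, h] = 0.  Thus
    h is an ideal (lck_ker_ideal) with quotient spanned by A and B.  It is stable
    under J, and the restriction of Omega to h is closed because theta vanishes
    there: h is a Kaehler Lie algebra, unimodular because it is an ideal of a
    unimodular algebra.  It remains to see that unimodular Kaehler Lie algebras
    are solvable; they turn out to be metabelian.

    The first half of this is Hano's theorem that a unimodular Kaehler Lie algebra
    is flat (kahler_flat).  Unimodularity plays the role of Stokes' theorem on a
    compact quotient.  The Ricci form is exact, the pairing of an exact form with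
    the powers of the Kaehler form integrates to zero, and this makes first the
    norm of the Ricci form vanish (ricci_flat) and then that of the whole
    curvature, through the transgression of the trace of its square.  Both
    statements are obtained here by purely algebraic contractions over an
    orthonormal basis; each step moves a skew endomorphism from one slot to
    the other (frame_skew) or permutes a trace cyclically.

    The second half is Milnor's theorem on flat metrics (flat_lie).  When the
    curvature vanishes, X |-> N X, the covariant derivative, is an orthogonal
    representation; the trace form of this representation is an invariant scalar
    product modulo its kernel, and one trace computation with the corresponding
    Casimir operator shows that N kills all brackets.  As
    [X, Y] = N X Y - N Y X, two brackets commute. *)

Set Implicit Arguments.
Unset Strict Implicit.
Unset Printing Implicit Defensive.

Import Order.TTheory GRing.Theory Num.Theory.
Local Open Scope ring_scope.

(** * Linear maps, scalar products and frames *)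

Section Linear.
Context {F : fieldType} {U V W : vectType F}.

Definition bilinear_map (phi : U -> V -> W) : Prop :=
  (forall Y, linear (phi^~ Y)) /\ (forall X, linear (phi X)).

Lemma linfunE (f : U -> W) : linear f -> linfun f =1 f.
Proof.
move=> fL; pose m := GRing.isLinear.Build F U W _ f fL.
pose f' : {linear U -> W} := HB.pack f m.
exact: (lfunE f').
Qed.

Lemma linear_lfun (f : U -> W) : linear f -> exists h : 'Hom(U, W), h =1 f.
Proof. by move=> /linfunE; exists (linfun f). Qed.

Lemma comp_lfunPl (a : F) (f f' : 'Hom(V, W)) (h : 'Hom(U, V)) :
  ((a *: f + f') \o h)%VF = a *: (f \o h)%VF + (f' \o h)%VF.
Proof. by rewrite comp_lfunDl comp_lfunZl. Qed.

Lemma comp_lfunPr (a : F) (f : 'Hom(V, W)) (h h' : 'Hom(U, V)) :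
  (f \o (a *: h + h'))%VF = a *: (f \o h)%VF + (f \o h')%VF.
Proof. by rewrite comp_lfunDr comp_lfunZr. Qed.

Lemma lfunPl (a : F) (f f' : 'Hom(U, V)) X :
  (a *: f + f') X = a *: f X + f' X.
Proof. by rewrite add_lfunE scale_lfunE. Qed.

End Linear.

Lemma bilinear_lfun {F : fieldType} {U V W : vectType F} (phi : U -> V -> W) :
  bilinear_map phi -> exists N : 'Hom(U, 'Hom(V, W)), forall X Y, N X Y = phi X Y.
Proof.
case=> phil phir.
have [|N NE] := @linear_lfun _ _ _ (fun X => linfun (phi X)).
  by move=> a X X'; apply/lfunP => Y; rewrite lfunPl !(linfunE (phir _)) phil.
by exists N => X Y; rewrite NE (linfunE (phir X)).
Qed.

Lemma scale_regular {F : fieldType} (a : F) (x : F^o) : a *: x = a * x.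
Proof. by []. Qed.

Lemma lfunPr {F : fieldType} {U V : vectType F} (f : 'Hom(U, V)) a X X' :
  f (a *: X + X') = a *: f X + f X'.
Proof. exact: linearP. Qed.

Section Forms.
Context {R : rcfType} {V : vectType R}.
Implicit Types (X Y Z : V).

(** Gram-Schmidt for a form that may degenerate: the remainder is isotropic
    rather than zero.  It is used for the scalar product, and for a trace form
    whose kernel has to be kept. *)
Lemma psd_frame (B : 'Hom(V, 'Hom(V, R^o))) (W : {vspace V}) :
  (forall X Y, B X Y = B Y X) -> (forall X, 0 <= (B X X : R)) ->
  exists m (f : 'I_m -> V), (forall i, f i \in W) /\
    forall X, X \in W ->
      B (X - \sum_i B X (f i) *: f i) (X - \sum_i B X (f i) *: f i) = 0.
Proof.
move=> Bsym Bge0; have [n] := ubnP (\dim W); elim: n W => // n IHn W dimW.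
(* Split off a unit vector, if there is one, and go on in its orthogonal
   complement in W; otherwise every vector of W is isotropic. *)
have [[X [XW BX0]]|isoW] := boolp.EM (exists X, X \in W /\ B X X != 0); last first.
  exists 0%N, (fun _ => 0); split=> [[]//|X XW]; rewrite big_ord0 subr0.
  by apply/eqP; apply: contraPT isoW => BX; apply; exists X.
have [f0 f0W Bf0] : exists2 Y, Y \in W & B Y Y = 1.
  exists ((Num.sqrt (B X X))^-1 *: X); first by rewrite memvZ.
  rewrite linearZ /= linearZ /= scale_lfunE !scale_regular mulrA -expr2 exprVn.
  by rewrite sqr_sqrtr // mulVf.
pose b : 'Hom(V, R^o) := B f0.
have [|m [f [fW' fE]]] := IHn (W :&: lker b)%VS.
  rewrite -ltnS (leq_trans _ dimW) // ltnS ltn_neqAle dimvS ?capvSl // andbT.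
  apply: contraTN (oner_neq0 R) => /eqP dimE.
  have /eqP eqW : (W :&: lker b)%VS == W by rewrite eqEdim capvSl dimE leqnn.
  by move: f0W; rewrite -eqW memv_cap memv_ker Bf0 => /andP[_ /eqP ->]; rewrite eqxx.
have Bf i : B f0 (f i) = 0 by have /memv_capP[_] := fW' i; rewrite memv_ker => /eqP.
exists m.+1, (fun i => if unlift ord0 i is Some j then f j else f0); split=> [i|Y YW].
  by case: unliftP => [j _|_ //]; have /memv_capP[] := fW' j.
rewrite big_ord_recl unlift_none; under eq_bigr do rewrite liftK.
rewrite opprD addrA; set Y' := Y - B Y f0 *: f0.
have Y'W : Y' \in (W :&: lker b)%VS.
  rewrite memv_cap memvB ?memvZ //= memv_ker /b /Y' linearB /= linearZ /= Bf0 Bsym.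
  by rewrite !scale_regular mulr1 subrr.
under eq_bigr => i _.
  have -> : B Y (f i) = B Y' (f i).
    by rewrite linearB linearZ /= add_lfunE opp_lfunE scale_lfunE Bf scaler0 subr0.
  over.
exact: fE.
Qed.
End Forms.

Section Metric.
Context {R : rcfType} {V : vectType R} (g : {dot V for idfun}).
Implicit Types (X Y Z : V) (A f h : 'End(V)).

Lemma dotPl a X Y Z : g (a *: X + Y) Z = a * g X Z + g Y Z.
Proof. exact: linearPl. Qed.

Lemma dotPr a X Y Z : g X (a *: Y + Z) = a * g X Y + g X Z.
Proof. exact: linearPr. Qed.

Lemma dotDl X Y Z : g (X + Y) Z = g X Z + g Y Z.
Proof. exact: linearDl. Qed.

Lemma dotDr X Y Z : g X (Y + Z) = g X Y + g X Z.
Proof. exact: linearDr. Qed.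

Lemma dotNl X Y : g (- X) Y = - g X Y.
Proof. exact: linearNl. Qed.

Lemma dotNr X Y : g X (- Y) = - g X Y.
Proof. exact: linearNr. Qed.

Lemma dot0l Y : g 0 Y = 0.
Proof. exact: linear0l. Qed.

Lemma dot0r Y : g Y 0 = 0.
Proof. exact: linear0r. Qed.

Lemma dotZl a X Y : g (a *: X) Y = a * g X Y.
Proof. exact: linearZl_LR. Qed.

Lemma dotZr a X Y : g X (a *: Y) = a * g X Y.
Proof. exact: linearZr_LR. Qed.

Lemma dotsuml I r (P : pred I) (F : I -> V) Y :
  g (\sum_(i <- r | P i) F i) Y = \sum_(i <- r | P i) g (F i) Y.
Proof. exact: linear_sumlz. Qed.

Lemma dotsumr I r (P : pred I) (F : I -> V) Y :
  g Y (\sum_(i <- r | P i) F i) = \sum_(i <- r | P i) g Y (F i).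
Proof. exact: linear_sumr. Qed.

Definition dotE := (dotDl, dotDr, dotNl, dotNr, dot0l, dot0r).

Lemma dotC X Y : g X Y = g Y X.
Proof. by rewrite hermC expr0 mul1r. Qed.

Lemma dot_ge0 X : 0 <= g X X.
Proof.
by have [->|/neq0_dnorm_gt0/ltW//] := eqVneq X 0; rewrite linear0l.
Qed.

Lemma dot_eq0 X : g X X = 0 -> X = 0.
Proof. by apply: contra_eq => /neq0_dnorm_gt0/lt0r_neq0. Qed.

Lemma dot_inj X Y : (forall Z, g X Z = g Y Z) -> X = Y.
Proof.
by move=> XY; apply/subr0_eq/dot_eq0; rewrite linearBl /= XY subrr.
Qed.

Definition skewadj A : Prop := forall X Y, g (A X) Y = - g X (A Y).

(** Completeness alone says that the sum of e_i tensor e_i is the inverse of g,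
    and this is all that contractions need. *)
Definition frame m (e : 'I_m -> V) : Prop :=
  forall X, X = \sum_i g X (e i) *: e i.

Lemma dot_lfun : exists B : 'Hom(V, 'Hom(V, R^o)), forall X Y, B X Y = g X Y.
Proof.
apply: (@bilinear_lfun R V V R^o (fun X Y => g X Y)).
by split=> [Y a X X'|X a Y Y'] /=; rewrite ?dotPl ?dotPr.
Qed.

Lemma orthonormal_frame (W : {vspace V}) :
  exists m (e : 'I_m -> V), (forall i, e i \in W) /\
    forall X, X \in W -> X = \sum_i g X (e i) *: e i.
Proof.
have [B BE] := dot_lfun.
have [X Y|X|m [e [eW eB]]] := psd_frame (B := B) W.
- by rewrite !BE dotC.
- by rewrite BE dot_ge0.
exists m, e; split=> // X XW; apply/subr0_eq/dot_eq0; rewrite -[RHS](eB X XW) BE.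
by under [in RHS]eq_bigr do rewrite BE.
Qed.

Section Frame.
Context {m : nat} {e : 'I_m -> V} (eF : frame e).

(** The workhorse of all the contractions below.  The tensor inverse to g is
    invariant under skew endomorphisms, so that such an endomorphism moves from
    one slot of a contracted bilinear expression to the other with a sign.  The
    complex structure and the covariant derivatives are of this kind. *)
Lemma frame_skew {W : vectType R} (phi : V -> V -> W) A :
  bilinear_map phi -> skewadj A ->
  \sum_i phi (A (e i)) (e i) = - \sum_i phi (e i) (A (e i)).
Proof.
move=> phiB Ask; have [p pE] := bilinear_lfun phiB.
have El i : phi (A (e i)) (e i) = \sum_j g (A (e i)) (e j) *: p (e j) (e i).
  rewrite -pE {1}[A (e i)]eF linear_sum sum_lfunE.
  by apply: eq_bigr => j _; rewrite linearZ lfunE.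
have Er i : phi (e i) (A (e i)) = \sum_j g (A (e i)) (e j) *: p (e i) (e j).
  by rewrite -pE {1}[A (e i)]eF linear_sum; apply: eq_bigr => j _; rewrite linearZ.
rewrite (eq_bigr _ (fun i _ => El i)) (eq_bigr _ (fun i _ => Er i)) exchange_big /=.
rewrite -sumrN; apply: eq_bigr => j _; rewrite -sumrN; apply: eq_bigr => i _.
by rewrite Ask dotC scaleNr.
Qed.

Definition trace f : R := \sum_i g (f (e i)) (e i).

Lemma traceP a f h : trace (a *: f + h) = a * trace f + trace h.
Proof.
rewrite /trace mulr_sumr -big_split; apply: eq_bigr => i _ /=.
by rewrite lfunPl dotPl.
Qed.

Lemma traceD f h : trace (f + h) = trace f + trace h.
Proof. by rewrite -[f]scale1r traceP mul1r scale1r. Qed.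

Lemma trace0 : trace 0 = 0.
Proof. by apply: (addrI (trace 0)); rewrite -traceD !addr0. Qed.

Lemma traceN f : trace (- f) = - trace f.
Proof. by rewrite -[- f]addr0 -scaleN1r traceP trace0 mulN1r addr0. Qed.

Lemma trace_sum I r (P : pred I) (F : I -> 'End(V)) :
  trace (\sum_(i <- r | P i) F i) = \sum_(i <- r | P i) trace (F i).
Proof. exact: (big_morph _ traceD trace0). Qed.

Lemma traceC f h : trace (f \o h)%VF = trace (h \o f)%VF.
Proof.
have E f' h' : trace (f' \o h')%VF =
    \sum_i \sum_j g (h' (e i)) (e j) * g (f' (e j)) (e i).
  apply: eq_bigr => i _; rewrite comp_lfunE [h' (e i)]eF linear_sum linear_sumlz.
  by apply: eq_bigr => j _; rewrite -eF linearZ linearZl_LR.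
rewrite !E exchange_big; apply: eq_bigr => j _; apply: eq_bigr => i _.
by rewrite mulrC.
Qed.

End Frame.
End Metric.

Arguments trace {R V} g {m} e f.

Lemma lfun_trace_frame {R : rcfType} {L : lieAlgType R} (g : {dot L for idfun})
    m (e : 'I_m -> L) : frame g e -> forall f : 'End(L), lfun_trace f = trace g e f.
Proof.
move=> eF f; pose b := vbasis {:L}.
have co j X : coord b j X = g X (\sum_i coord b j (e i) *: e i).
  rewrite {1}[X]eF !linear_sum; apply: eq_bigr => i _.
  by rewrite linearZ /= linearZr_LR /= mulrC.
transitivity (\sum_(j < \dim {:L}) g (f b`_j) (\sum_i coord b j (e i) *: e i)).
  apply: eq_bigr => j _; rewrite -co.
  by rewrite mxE /= passmx.vecof_delta mxE.
under eq_bigr do rewrite linear_sumr; rewrite exchange_big; apply: eq_bigr => i _ /=.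
transitivity (g (f (\sum_j coord b j (e i) *: b`_j)) (e i)).
  rewrite linear_sum linear_sumlz; apply: eq_bigr => j _.
  by rewrite linearZr_LR /= linearZ /= linearZl_LR.
by congr (g (f _) _); rewrite [RHS](coord_vbasis (memvf (e i))).
Qed.

Section LieLinear.
Context {F : fieldType} {L : lieAlgType F}.
Implicit Types X Y Z : L.

Lemma liePl a X X' Y : [< a *: X + X', Y >] = a *: [< X, Y >] + [< X', Y >].
Proof. exact: lie_linearl. Qed.

Lemma liePr a X Y Y' : [< X, a *: Y + Y' >] = a *: [< X, Y >] + [< X, Y' >].
Proof. exact: lie_linearr. Qed.

Lemma lieC X Y : [< Y, X >] = - [< X, Y >].
Proof.
apply/eqP; rewrite -addr_eq0 addrC; apply/eqP; have := liexx (X + Y).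
by rewrite linearDl /= !linearDr /= !liexx add0r addr0.
Qed.

End LieLinear.

(** Distributes an expression over a vector a *: X + X' that occurs in it. *)
Definition linPE := (@lfunPr, @lfunPl, @comp_lfunPl, @comp_lfunPr, @liePl, @liePr,
  @dotPl, @dotPr, @traceP).

Ltac bilin := split=> [? ? ? ?|? ? ? ?] /=; rewrite !linPE; done.

(** * The Levi-Civita connection of a Lie algebra and its curvature *)

Section LeviCivita.
Context {R : rcfType} {L : lieAlgType R} (g : {dot L for idfun}).
Implicit Types X Y Z W : L.

Definition levi_civita (N : 'Hom(L, 'End(L))) : Prop :=
  (forall X, skewadj g (N X)) /\ (forall X Y, [< X, Y >] = N X Y - N Y X).

(** Koszul's formula defines the connection. *)
Lemma levi_civita_exists : exists N, levi_civita N.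
Proof.
have [m [e [_ eF]]] := orthonormal_frame g fullv.
pose k X Y Z : R := (g [< X, Y >] Z - g [< Y, Z >] X + g [< Z, X >] Y) / 2.
have kPl a X X' Y Z : k (a *: X + X') Y Z = a * k X Y Z + k X' Y Z.
  by rewrite /k !linPE; lra.
have kPm a X Y Y' Z : k X (a *: Y + Y') Z = a * k X Y Z + k X Y' Z.
  by rewrite /k !linPE; lra.
have [|N NE] := @bilinear_lfun R L L L (fun X Y => \sum_i k X Y (e i) *: e i).
  split=> [Y a X X'|X a Y Y'] /=; rewrite scaler_sumr -big_split;
    by apply: eq_bigr => i _; rewrite (kPl, kPm) scalerDl scalerA.
have gN X Y Z : g (N X Y) Z = k X Y Z.
  have [|h hE] := @linear_lfun R L R^o (k X Y).
    by move=> a Z1 Z2; rewrite /k !linPE /GRing.scale /=; lra.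
  rewrite NE dotsuml -hE {2}[Z](eF _ (memvf _)) linear_sum; apply: eq_bigr => i _.
  by rewrite linearZ /= linearZl_LR hE mulrC dotC.
exists N; split=> [X Y Z|X Y].
  rewrite [RHS in _ = - RHS]dotC !gN /k (lieC Y Z) (lieC X Y) (lieC Z X).
  by rewrite !dotE; lra.
apply: (@dot_inj _ _ g) => Z.
by rewrite !dotE !gN /k (lieC X Y) (lieC X Z) (lieC Y Z) !dotE; lra.
Qed.

End LeviCivita.

Section Curvature.
Context {R : rcfType} {L : lieAlgType R} {g : {dot L for idfun}}.
Context {N : 'Hom(L, 'End(L))} (NLC : levi_civita g N).
Implicit Types X Y Z W : L.

Let NK X : skewadj g (N X). Proof. by case: NLC. Qed.
Let NT X Y : [< X, Y >] = N X Y - N Y X. Proof. by case: NLC. Qed.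

Lemma koszul X Y Z :
  2 * g (N X Y) Z = g [< X, Y >] Z - g [< Y, Z >] X + g [< Z, X >] Y.
Proof.
have K X' Y' Z' : g (N X' Y') Z' = - g (N X' Z') Y' by rewrite NK dotC.
rewrite !NT !dotE; have := K X Y Z; have := K Y X Z; have := K Z X Y; lra.
Qed.

Definition curvature X Y : 'End(L) :=
  ((N X \o N Y) - (N Y \o N X) - N [< X, Y >])%VF.

Local Notation curv := curvature.

Lemma curvE X Y Z : curv X Y Z = N X (N Y Z) - N Y (N X Z) - N [< X, Y >] Z.
Proof. by rewrite !(add_lfunE, opp_lfunE, comp_lfunE). Qed.

Lemma curvPl a X X' Y : curv (a *: X + X') Y = a *: curv X Y + curv X' Y.
Proof.
rewrite /curvature !linPE !opprD (addrACA (a *: _)) (addrACA (_ + _)).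
by rewrite -!scalerN -!scalerDr.
Qed.

Lemma curvPr a X Y Y' : curv X (a *: Y + Y') = a *: curv X Y + curv X Y'.
Proof.
rewrite /curvature !linPE !opprD (addrACA (a *: _)) (addrACA (_ + _)).
by rewrite -!scalerN -!scalerDr.
Qed.

Lemma curvC X Y : curv Y X = - curv X Y.
Proof. by rewrite /curvature (lieC X Y) linearN /= opprD !opprB opprK. Qed.

Lemma curv_skew X Y : skewadj g (curv X Y).
Proof. by move=> Z W; rewrite !curvE !dotE !NK; lra. Qed.

Lemma bianchi X Y Z : curv X Y Z + curv Y Z X + curv Z X Y = 0.
Proof.
apply: (@dot_inj _ _ g) => W; have := congr1 (g^~ W) (lie_jacobi X Y Z).
have E X' Y' Z' : [< X', [< Y', Z' >] >] =
    N X' (N Y' Z') - N X' (N Z' Y') - N [< Y', Z' >] X'.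
  by rewrite NT (NT Y' Z') linearB.
rewrite !E !curvE /= !dotE; lra.
Qed.

(** The classical consequence of the Bianchi identity: an alternating sum of
    its four instances leaves only the two terms that are compared. *)
Lemma curv_pair X Y Z W : g (curv X Y Z) W = g (curv Z W X) Y.
Proof.
have b X' Y' Z' W' : g (curv X' Y' Z') W' + g (curv Y' Z' X') W' +
    g (curv Z' X' Y') W' = 0 by rewrite -!dotDl bianchi dot0l.
have s X' Y' Z' W' : g (curv Y' X' Z') W' = - g (curv X' Y' Z') W'.
  by rewrite curvC opp_lfunE dotNl.
have k X' Y' Z' W' : g (curv X' Y' W') Z' = - g (curv X' Y' Z') W'.
  by rewrite curv_skew dotC.
have := b X Y Z W; have := b Y Z W X; have := b Z W X Y; have := b W X Y Z.
rewrite (k X Y Z W) (k Y Z X W) (k Z W X Y) (k W X Y Z).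
rewrite (s Z X W Y) (k Z X Y W) (s W Y X Z) (k W Y Z X); lra.
Qed.
End Curvature.

Arguments curvature {R L} N X Y.

(** * Unimodular Kaehler Lie algebras are flat *)

Section Kahler.
Context {R : rcfType} {L : lieAlgType R} (g : {dot L for idfun}) (J : 'End(L)).
Implicit Types X Y Z W : L.

Definition kahler : Prop :=
  [/\ skewadj g J, (J \o J)%VF = - \1%VF, forall X Y, nijenhuis J X Y = 0
    & forall X Y Z, d2 (fun X Y => g X (J Y)) X Y Z = 0].

Hypothesis K : kahler.

Let JK : skewadj g J. Proof. by case: K. Qed.
Let JJ X : J (J X) = - X.
Proof. by case: K => _ J2 _ _; rewrite -comp_lfunE J2 opp_lfunE id_lfunE. Qed.

Context {N : 'Hom(L, 'End(L))} (NLC : levi_civita g N).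

Let NK X : skewadj g (N X). Proof. by case: NLC. Qed.
Let NT X Y : [< X, Y >] = N X Y - N Y X. Proof. by case: NLC. Qed.

(** Subtract the closedness of the Kaehler form at (X, JY, JZ) from that at
    (X, Y, Z) and use the Nijenhuis tensor at (Y, Z): Koszul's formulas for
    the two sides then agree. *)
Lemma levi_civita_J X Y : N X (J Y) = J (N X Y).
Proof.
case: K => _ _ nij dO.
apply: (@dot_inj _ _ g) => Z.
have -> : g (J (N X Y)) Z = - g (N X Y) (J Z) by rewrite JK.
have := koszul NLC X (J Y) Z; have := koszul NLC X Y (J Z).
have := dO X Y Z; have := dO X (J Y) (J Z); rewrite /d2 !JJ.
have := congr1 (g^~ (J X)) (nij Y Z); rewrite /nijenhuis /= !dotE.
rewrite !(JK [< _, _ >] (J X)) !JJ !dotE; lra.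
Qed.

Let NJ := levi_civita_J.

Context {m : nat} {e : 'I_m -> L} (eF : frame g e).
(** This is unimodularity, see unimodular_div0: left-invariant vector fields
    are divergence free. *)
Hypothesis N0 : \sum_i N (e i) (e i) = 0.

Local Notation tr := (trace g e).
Local Notation curv := (curvature N).

Lemma div_J : \sum_i N (J (e i)) (e i) = 0.
Proof.
rewrite (frame_skew eF (phi := fun X Y => N X Y)) //; last by bilin.
by under eq_bigr do rewrite NJ; rewrite -linear_sum N0 linear0 oppr0.
Qed.

Lemma sum_lieJ : \sum_i [< e i, J (e i) >] = 0.
Proof.
under eq_bigr do rewrite NT NJ.
by rewrite sumrB -linear_sum N0 div_J linear0 subr0.
Qed.

(** The Ricci form, as an endomorphism: half of the contraction of the curvature
    with the Kaehler form, see sum_curvJ. *)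
Definition ricci : 'End(L) := \sum_i (N (e i) \o N (J (e i)))%VF.

Let ricciE X : ricci X = \sum_i N (e i) (N (J (e i)) X).
Proof. by rewrite sum_lfunE; under eq_bigr do rewrite comp_lfunE. Qed.

Let ricciN : \sum_i (N (J (e i)) \o N (e i))%VF = - ricci.
Proof.
by rewrite (frame_skew eF (phi := fun X Y => (N X \o N Y)%VF)) //; bilin.
Qed.

Let ricciNE X : \sum_i N (J (e i)) (N (e i) X) = - ricci X.
Proof.
rewrite -opp_lfunE -ricciN sum_lfunE.
by under [RHS]eq_bigr do rewrite comp_lfunE.
Qed.

Lemma ricciJ X : ricci (J X) = J (ricci X).
Proof. by rewrite !ricciE linear_sum; under eq_bigr do rewrite !NJ. Qed.

Lemma ricci_skew : skewadj g ricci.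
Proof.
move=> X Y; rewrite -dotNr -ricciNE ricciE dotsuml dotsumr.
by apply: eq_bigr => i _; rewrite !NK opprK.
Qed.

Lemma sum_curvJ X : \sum_i curv (e i) (J (e i)) X = 2 *: ricci X.
Proof.
under eq_bigr do rewrite curvE.
rewrite !sumrB -ricciE ricciNE opprK -sum_lfunE -linear_sum sum_lieJ linear0.
by rewrite lfunE /= subr0 scaler_nat mulr2n.
Qed.

(** The Bianchi identity on (J e_i, X, e_i): two of its three contractions agree
    because J is skew, and the third is sum_curvJ. *)
Lemma curv_div X : \sum_i curv (J (e i)) X (e i) = - ricci X.
Proof.
have E : \sum_i curv X (e i) (J (e i)) = \sum_i curv (J (e i)) X (e i).
  apply: oppr_inj; rewrite -(frame_skew eF (phi := fun Y Z => curv X Y Z)) //.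
    by rewrite -sumrN; apply: eq_bigr => i _; rewrite curvC opp_lfunE.
  by split=> [Z a Y Y'|Y a Z Z'] /=; rewrite ?linPE // curvPr linPE.
apply: (@dot_inj _ _ g) => Z.
have : g (\sum_i (curv (J (e i)) X (e i) + curv X (e i) (J (e i)) +
                   curv (e i) (J (e i)) X)) Z = 0.
  by rewrite big1 ?dot0l // => i _; apply: bianchi NLC _ _ _.
rewrite !big_split /= E sum_curvJ !dotE scaler_nat mulr2n dotE; lra.
Qed.

(** By pair symmetry it is enough that the curvature operators commute with the
    orthogonal map J. *)
Lemma curvJ X Y : curv (J X) (J Y) = curv X Y.
Proof.
apply/lfunP => Z; apply: (@dot_inj _ _ g) => W.
have cJ U V T : curv U V (J T) = J (curv U V T).
  by rewrite !curvE !NJ !linearB.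
by rewrite !(curv_pair NLC _ _ Z W) cJ JK JJ dotE opprK.
Qed.

Let compNJ X : (N X \o J)%VF = (J \o N X)%VF.
Proof. by apply/lfunP => Y; rewrite !comp_lfunE NJ. Qed.

(** The Ricci form is exact: the commutator part of the curvature does not
    contribute to the trace against J. *)
Lemma ricci_form X Y : 2 * g (ricci X) Y = tr (J \o N [< X, Y >])%VF.
Proof.
have -> : 2 * g (ricci X) Y = - tr (J \o curv X Y)%VF.
  transitivity (g (\sum_i curv (e i) (J (e i)) X) Y).
    by rewrite sum_curvJ linearZl_LR.
  rewrite dotsuml /trace -sumrN; apply: eq_bigr => i _.
  by rewrite (curv_pair NLC) comp_lfunE JK opprK.
rewrite /curvature !(comp_lfunDr, comp_lfunNr) !(traceD, traceN) !comp_lfunA.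
by rewrite (traceC eF) comp_lfunA compNJ; lra.
Qed.

Let xi X := tr (J \o N X)%VF.
Let xiD X Y : xi (X + Y) = xi X + xi Y.
Proof. by rewrite /xi linearD comp_lfunDr traceD. Qed.
Let xi0 : xi 0 = 0. Proof. by rewrite /xi linear0 comp_lfun0r trace0. Qed.

Lemma ricci_closed X Y Z : g (ricci [< X, Y >]) Z + g (ricci [< Y, Z >]) X +
  g (ricci [< Z, X >]) Y = 0.
Proof.
have : xi (- [< Z, [< X, Y >] >] - [< X, [< Y, Z >] >] - [< Y, [< Z, X >] >]) = 0.
  by rewrite -!opprD -addrA addrC lie_jacobi oppr0.
rewrite !xiD -!lieC /xi -!ricci_form; lra.
Qed.

(** A closed form that is invariant under J is divergence free as soon as its
    trace against J is constant.  Here the identity ricci_closed is contracted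
    with the Kaehler form in two of its slots; the term D1 is the trace of a
    skew endomorphism times a symmetric one. *)
Lemma div_ricci : \sum_i N (e i) (ricci (e i)) = 0.
Proof.
have D Z : \sum_i g (ricci [< Z, e i >]) (J (e i)) = 0.
  have E : \sum_i g (ricci [< J (e i), Z >]) (e i) =
           \sum_i g (ricci [< Z, e i >]) (J (e i)).
    rewrite (frame_skew (W := R^o) eF
      (phi := fun X Y => g (ricci [< X, Z >]) Y)) //.
      rewrite -sumrN; apply: eq_bigr => i _.
      by rewrite (lieC Z) (linearN ricci) dotNl opprK.
    by bilin.
  have : \sum_i (g (ricci [< e i, J (e i) >]) Z + g (ricci [< J (e i), Z >]) (e i) +
                g (ricci [< Z, e i >]) (J (e i))) = 0.
    by rewrite big1 // => i _; apply: ricci_closed.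
  rewrite !big_split /= E -dotsuml -linear_sum sum_lieJ linear0 dot0l; lra.
have D1 Z : \sum_i g (ricci (N Z (e i))) (J (e i)) = 0.
  have : \sum_i g (ricci (N Z (e i))) (J (e i)) =
      - \sum_i g (ricci (N Z (e i))) (J (e i)).
    rewrite {1}(frame_skew (W := R^o) eF (phi := fun X Y => g (ricci X) (J Y))) //.
      congr (- _); apply: eq_bigr => i _.
      by rewrite ricci_skew ricciJ -JK dotC.
    by bilin.
  lra.
apply: (@dot_inj _ _ g) => Z; rewrite dot0l dotsuml.
have := D (J Z); under eq_bigr do rewrite NT (linearB ricci) dotDl dotNl.
rewrite sumrB D1 sub0r => /eqP; rewrite oppr_eq0 => /eqP s0; rewrite -[RHS]s0.
apply: eq_bigr => i _.
by rewrite ricci_skew ricciJ !NJ JK JJ dotNr !opprK NK dotC.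
Qed.

(** Since the Ricci form is exact and divergence free, integration by parts
    gives it norm zero: its norm is the primitive xi of ricci_form applied to
    a divergence. *)
Lemma ricci_flat : ricci = 0.
Proof.
have s0 : \sum_i g (ricci (e i)) (ricci (e i)) = 0.
  have n2 : (2 : R) != 0 by rewrite pnatr_eq0.
  apply: (mulfI n2); rewrite mulr0 mulr_sumr.
  under eq_bigr do rewrite ricci_form -/(xi _).
  rewrite -(big_morph xi xiD xi0) -[RHS]xi0; congr xi.
  under eq_bigr do rewrite NT; rewrite sumrB div_ricci sub0r.
  rewrite (frame_skew eF (phi := fun X Y => N X Y)) ?opprK ?div_ricci //.
    by bilin.
  exact: ricci_skew.
apply/lfunP => X; rewrite [X]eF !linear_sum; apply: eq_bigr => i _.
rewrite !linearZ /=; congr (_ *: _); rewrite lfunE /=; apply: (@dot_eq0 _ _ g).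
by apply: (psumr_eq0P _ s0) => // j _; apply: dot_ge0.
Qed.

(** Expanding the curvatures in curv_div leaves this contraction, which therefore
    vanishes with the Ricci form. *)
Lemma div_levi_civita X : \sum_i N (N (J (e i)) X) (e i) = 0.
Proof.
have A : \sum_i N (J (N X (e i))) (e i) = - \sum_i N (J (e i)) (N X (e i)).
  by rewrite (frame_skew eF (phi := fun Y Z => N (J Y) Z)) //; bilin.
have := curv_div X; rewrite ricci_flat lfunE /= oppr0 => D0.
apply: oppr_inj; rewrite oppr0 -[RHS]D0.
under [RHS]eq_bigr do rewrite curvE NT (linearB N) (add_lfunE (N _)) opp_lfunE NJ.
rewrite !sumrB A -linear_sum div_J linear0 subr0 opprK.
by rewrite opprD addrA addrAC addrN add0r.
Qed.

Let cyc4 (A B C D : 'End(L)) :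
  tr (A \o B \o (C \o D))%VF = tr (B \o C \o (D \o A))%VF.
Proof. by rewrite -comp_lfunA (traceC eF) -!comp_lfunA. Qed.

Let cyc3 (A B C : 'End(L)) : tr (A \o B \o C)%VF = tr (C \o A \o B)%VF.
Proof. by rewrite (traceC eF) -!comp_lfunA. Qed.

Let ricci0 : \sum_i (N (J (e i)) \o N (e i))%VF = 0.
Proof. by rewrite ricciN ricci_flat oppr0. Qed.

Let comp_suml I r (P : pred I)
    (F : I -> 'End(L)) (A : 'End(L)) :
  (\sum_(i <- r | P i) (F i \o A) = (\sum_(i <- r | P i) F i) \o A)%VF.
Proof.
by apply/esym/(big_morph (fun B => comp_lfun B A)) => [B C|];
  rewrite ?comp_lfunDl ?comp_lfun0l.
Qed.

Let comp_sumr I r (P : pred I)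
    (F : I -> 'End(L)) (A : 'End(L)) :
  (\sum_(i <- r | P i) (A \o F i) = A \o (\sum_(i <- r | P i) F i))%VF.
Proof.
by apply/esym/(big_morph (comp_lfun A)) => [B C|];
  rewrite ?comp_lfunDr ?comp_lfun0r.
Qed.

(* Passing from (X, Y) to (J X, J Y) puts a J into the curvature, which is what
   makes ricci0 and div_levi_civita applicable to its contractions. *)
Let curvJE X Y : curv X Y = ((N (J X) \o N (J Y)) - (N (J Y) \o N (J X))
  - N (J (N (J X) Y)) + N (J (N (J Y) X)))%VF.
Proof.
by rewrite -curvJ /curvature NT !NJ (linearB N) opprB addrA addrAC.
Qed.

(** The curvature splits into four terms by curvJE.  The first changes sign under
    a cyclic permutation and a move of J, the second contains ricci0, and the
    other two cancel because J o N X is symmetric.  In terms of forms, the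
    trace of the third power of the connection form has an exterior derivative
    whose double contraction with the Kaehler form is zero, and this is what
    remains of it when the Ricci form vanishes. *)
Lemma tr_curv_NN :
  \sum_i \sum_j tr (curv (e i) (e j) \o (N (e i) \o N (e j)))%VF = 0.
Proof.
have P1 : \sum_i \sum_j tr (N (J (e i)) \o N (J (e j)) \o (N (e i) \o N (e j)))%VF = 0.
  set s := LHS; have : s = - s; last by lra.
  rewrite {1}/s exchange_big /= -sumrN; apply: eq_bigr => i _.
  under eq_bigr do rewrite cyc4.
  rewrite (frame_skew (W := R^o) eF (phi := fun X Y =>
    tr (N (J (e i)) \o N X \o (N (e i) \o N Y))%VF)) ?opprK //.
  by bilin.
have P2 : \sum_i \sum_j tr (N (J (e j)) \o N (J (e i)) \o (N (e i) \o N (e j)))%VF = 0.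
  rewrite exchange_big big1 //= => j _.
  under eq_bigr do rewrite comp_lfunA -(comp_lfunA (N (J (e j)))).
  rewrite -[LHS]trace_sum comp_suml comp_sumr ricci0 comp_lfun0r comp_lfun0l.
  exact: trace0.
have P3 : \sum_i \sum_j tr (N (J (N (J (e i)) (e j))) \o (N (e i) \o N (e j)))%VF =
          \sum_i \sum_j tr (N (J (N (J (e j)) (e i))) \o (N (e i) \o N (e j)))%VF.
  rewrite [RHS]exchange_big /=; apply: eq_bigr => i _.
  rewrite (frame_skew (W := R^o) eF (phi := fun X Y =>
    tr (N (J X) \o (N (e i) \o N Y))%VF)) //; last by bilin.
  rewrite (frame_skew (W := R^o) eF (phi := fun X Y =>
    tr (N X \o (N (e i) \o N (N (J (e i)) Y)))%VF)) ?opprK //; last by bilin.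
  by apply: eq_bigr => j _; rewrite comp_lfunA cyc3 NJ comp_lfunA.
under eq_bigr => i _.
  under eq_bigr => j _ do
    rewrite curvJE !(comp_lfunDl, comp_lfunNl) !(traceD, traceN).
  rewrite !big_split /= !sumrN; over.
by rewrite !big_split /= !sumrN P1 P2 P3; lra.
Qed.

Let frame_skew_r {W : vectType R} (phi : L -> L -> W) A :
  bilinear_map phi -> skewadj g A ->
  \sum_i phi (e i) (A (e i)) = - \sum_i phi (A (e i)) (e i).
Proof. by move=> phiB Ask; rewrite (frame_skew eF phiB Ask) opprK. Qed.

(** Again by curvJE: the first two terms cancel, the third contains ricci0 and
    the fourth div_levi_civita. *)
Lemma tr_curv_N2 :
  \sum_i \sum_j tr (curv (e i) (e j) \o N (N (e i) (e j)))%VF = 0.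
Proof.
have Q1 i : \sum_j tr (N (J (e i)) \o N (J (e j)) \o N (N (e i) (e j)))%VF =
            \sum_j tr (N (J (e j)) \o N (J (e i)) \o N (N (e i) (e j)))%VF.
  rewrite (frame_skew_r (W := R^o) (phi := fun X Y =>
    tr (N (J (e i)) \o N (J X) \o N Y)%VF)) //; last by bilin.
  under eq_bigr do rewrite -NJ.
  rewrite (frame_skew (W := R^o) eF (phi := fun X Y =>
    tr (N (J (e i)) \o N (N (e i) X) \o N Y)%VF)) ?opprK //; last by bilin.
  by apply: eq_bigr => j _; rewrite cyc3.
have Q2 : \sum_i \sum_j tr (N (J (N (J (e i)) (e j))) \o N (N (e i) (e j)))%VF = 0.
  under eq_bigr => i _.
    rewrite (frame_skew_r (W := R^o) (phi := fun X Y =>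
      tr (N (J (N (J (e i)) X)) \o N Y)%VF)) //; last by bilin.
    over.
  rewrite sumrN exchange_big big1 ?oppr0 // => j _ /=.
  rewrite -trace_sum comp_suml -!linear_sum ricciNE ricci_flat lfunE /= oppr0.
  by rewrite !linear0 comp_lfun0l trace0.
have Q3 : \sum_i \sum_j tr (N (J (N (J (e j)) (e i))) \o N (N (e i) (e j)))%VF = 0.
  rewrite exchange_big /=.
  under eq_bigr => j _.
    rewrite (frame_skew (W := R^o) eF (phi := fun X Y =>
      tr (N (J X) \o N (N Y (e j)))%VF)) //; last by bilin.
    over.
  rewrite sumrN exchange_big big1 ?oppr0 // => i _ /=.
  rewrite -trace_sum comp_sumr -!linear_sum div_levi_civita.
  by rewrite !linear0 comp_lfun0r trace0.
under eq_bigr => i _.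
  under eq_bigr => j _ do
    rewrite curvJE !(comp_lfunDl, comp_lfunNl) !(traceD, traceN).
  rewrite !big_split /= !sumrN Q1; over.
by rewrite !big_split /= !sumrN Q2 Q3; lra.
Qed.

(** The two preceding contractions are those that arise when one factor of the
    trace of the squared curvature is expanded, so this trace vanishes.  It is
    minus the squared norm of the curvature, whose operators are skew. *)
Lemma kahler_flat X Y : curv X Y = 0.
Proof.
have swap (M : L -> L -> 'End(L)) :
    \sum_i \sum_j tr (curv (e i) (e j) \o M (e i) (e j))%VF = 0 ->
    \sum_i \sum_j tr (curv (e i) (e j) \o M (e j) (e i))%VF = 0.
  move=> M0; rewrite exchange_big -[RHS]oppr0 -[in RHS]M0 -sumrN.
  apply: eq_bigr => i _; rewrite -sumrN; apply: eq_bigr => j _ /=.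
  by rewrite curvC comp_lfunNl traceN.
have T0 : \sum_i \sum_j tr (curv (e i) (e j) \o curv (e i) (e j))%VF = 0.
  have T1 := swap (fun X Y => N X \o N Y)%VF tr_curv_NN.
  have T2 := swap (fun X Y => N (N X Y)) tr_curv_N2.
  under eq_bigr => i _.
    under eq_bigr => j _ do
      rewrite {2}/curvature NT linearB /= !(comp_lfunDr, comp_lfunNr) !(traceD, traceN).
    rewrite !(big_split, sumrN) /=; over.
  by rewrite !(big_split, sumrN) /= tr_curv_NN tr_curv_N2 T1 T2; lra.
have ge0 i j k : 0 <= g (curv (e i) (e j) (e k)) (curv (e i) (e j) (e k)).
  exact: dot_ge0.
have S0 : \sum_i \sum_j \sum_k g (curv (e i) (e j) (e k)) (curv (e i) (e j) (e k)) = 0.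
  rewrite -[RHS]oppr0 -[in RHS]T0 -sumrN; apply: eq_bigr => i _.
  rewrite -sumrN; apply: eq_bigr => j _; rewrite -sumrN; apply: eq_bigr => k _.
  by rewrite comp_lfunE (curv_skew NLC) dotC.
have c0 i j k : curv (e i) (e j) (e k) = 0.
  apply: (@dot_eq0 _ _ g); move: k isT; apply: psumr_eq0P => [k _|]; first exact: ge0.
  move: j isT; apply: psumr_eq0P => [j _|]; first by apply: sumr_ge0.
  move: i isT; apply: psumr_eq0P => // i _; apply: sumr_ge0 => j _.
  by apply: sumr_ge0.
have [|C CE] := @bilinear_lfun R L L 'End(L) (fun X Y => curv X Y).
  by split=> [? ? ? ?|? ? ? ?] /=; rewrite ?curvPl ?curvPr.
apply/lfunP => Z; rewrite -CE [X]eF linear_sum sum_lfunE sum_lfunE lfunE /=.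
apply: big1 => i _; rewrite linearZ !lfun_simp [Y]eF linear_sum sum_lfunE.
rewrite big1 ?scaler0 // => j _; rewrite linearZ scale_lfunE /= CE.
rewrite [Z]eF linear_sum big1 ?scaler0 // => k _.
by rewrite linearZ /= c0 scaler0.
Qed.

End Kahler.

(** * Flat unimodular Lie algebras are metabelian *)

Section Flat.
Context {R : rcfType} {L : lieAlgType R} {g : {dot L for idfun}}.
Context {N : 'Hom(L, 'End(L))} (NLC : levi_civita g N).
Context {m : nat} {e : 'I_m -> L} (eF : frame g e).
Hypothesis N0 : \sum_i N (e i) (e i) = 0.
Hypothesis flatN : forall X Y, curvature N X Y = 0.
Implicit Types X Y Z U : L.

Local Notation tr := (trace g e).

Let NK X : skewadj g (N X). Proof. by case: NLC. Qed.
Let NT X Y : [< X, Y >] = N X Y - N Y X. Proof. by case: NLC. Qed.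
Let Nlie X Y : N [< X, Y >] = ((N X \o N Y) - (N Y \o N X))%VF.
Proof. by apply/esym/eqP; rewrite -subr_eq0 -/(curvature N X Y) flatN. Qed.

Let cyc3 (A B C : 'End(L)) : tr (A \o B \o C)%VF = tr (C \o A \o B)%VF.
Proof. by rewrite (traceC eF) -!comp_lfunA. Qed.

Let tform_exists : exists B : 'Hom(L, 'Hom(L, R^o)),
  forall X Y, B X Y = - tr (N X \o N Y)%VF.
Proof.
apply: (@bilinear_lfun R L L R^o (fun X Y => - tr (N X \o N Y)%VF)).
by split=> [Y a X X'|X a Y Y'] /=; rewrite !linPE /GRing.scale /= opprD mulrN.
Qed.

(** The kernel u of N is an ideal, because N is a representation when the
    curvature vanishes, and N X agrees on u with the bracket by X. *)
Lemma flat_lker X U : U \in lker N -> N X U \in lker N.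
Proof.
rewrite !memv_ker => /eqP NU.
have <- : [< X, U >] = N X U by rewrite NT NU lfunE subr0.
by rewrite Nlie NU comp_lfun0l comp_lfun0r subrr.
Qed.

(** Let b be the orthogonal complement of the kernel u of N, and B the form
    - tr (N X o N Y): it is positive on b, with kernel u, and invariant under
    the brackets.  For a B-orthonormal basis f_a of b put
    v = sum N (f_a) f_a.  Invariance of B gives N X v = sum N (f_a)^2 X for
    X in b, while N X v = 0 for X in u.  The trace of X |-> N X v is minus the
    product of v with sum N (e_i) e_i, hence 0, and that of sum N (f_a)^2
    on b is minus a sum of squares.  So the N (f_a), and with them all the
    N X, vanish on b: two elements of b have bracket zero, and the
    representation N factors through b. *)
Lemma flat_lie X Y : N [< X, Y >] = 0.
Proof.
have [p [h [hu hF]]] := orthonormal_frame g (lker N).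
(* Q is the orthogonal projection onto u, so that b is its kernel. *)
have [|Q QE] := @linear_lfun R L L (fun X => \sum_i g X (h i) *: h i).
  move=> a Z Z'; rewrite scaler_sumr -big_split; apply: eq_bigr => i _.
  by rewrite dotPl scalerDl scalerA.
have Qu Z : Q Z \in lker N by rewrite QE memv_suml // => i _; rewrite memvZ.
have Qid U : U \in lker N -> Q U = U by move=> /hF; rewrite QE => <-.
have gQ Z U : U \in lker N -> g (Q Z) U = g Z U.
  move=> /hF UE; rewrite QE UE dotsuml dotsumr; apply: eq_bigr => i _.
  by rewrite linearZl_LR linearZr_LR -UE mulrC dotC.
have bP Z : reflect (forall U, U \in lker N -> g Z U = 0) (Z \in lker Q).
  rewrite memv_ker; apply: (iffP eqP) => [QZ U Uu|ZU].
    by rewrite -gQ // QZ dot0l.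
  by apply: (@dot_eq0 _ _ g); rewrite gQ ?ZU.
have bN Z T : T \in lker Q -> N Z T \in lker Q.
  by move=> /bP Tu; apply/bP => U Uu; rewrite NK Tu ?oppr0 // flat_lker.
have PQ Z : Z - Q Z \in lker Q by rewrite memv_ker linearB /= (Qid (Q Z)) ?subrr.
have gP T Z : T \in lker Q -> g T Z = g T (Z - Q Z).
  by move=> /bP Tb; rewrite dotDr dotNr (Tb (Q Z)) ?Qu // oppr0 addr0.
have NP Z : N (Z - Q Z) = N Z.
  by have := Qu Z; rewrite memv_ker => /eqP NQ; rewrite linearB /= NQ subr0.
have [B BE] := tform_exists.
have BX Z : B Z Z = \sum_i g (N Z (e i)) (N Z (e i)).
  by rewrite BE -sumrN; apply: eq_bigr => i _; rewrite comp_lfunE NK opprK.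
have BX0 Z : B Z Z = 0 -> Z \in lker N.
  rewrite BX memv_ker => s0; apply/eqP/lfunP => T.
  rewrite [T]eF linear_sum lfunE; apply: big1 => i _; rewrite linearZ /=.
  rewrite (@dot_eq0 _ _ g (N Z (e i))) ?scaler0 //.
  by apply: (psumr_eq0P _ s0) => // j _; apply: dot_ge0.
have Bsym Z T : B Z T = B T Z by rewrite !BE traceC.
have [//|Z|q [f [fb fB]]] := psd_frame (B := B) (lker Q).
  by rewrite BX sumr_ge0 // => i _; apply: dot_ge0.
have fF Z : Z \in lker Q -> Z = \sum_i B Z (f i) *: f i.
  move=> Zb; apply/subr0_eq/(@dot_eq0 _ _ g).
  set Z' := Z - _.
  have Z'b : Z' \in lker Q by rewrite memvB ?memv_suml // => i _; rewrite memvZ.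
  by move/bP: Z'b; apply; apply/BX0/fB.
have Binv Z T1 T2 : B [< Z, T1 >] T2 = - B [< Z, T2 >] T1.
  rewrite !BE !Nlie !(comp_lfunDl, comp_lfunNl) !(traceD, traceN).
  rewrite (cyc3 (N T1) (N Z) (N T2)) (cyc3 (N T2) (N T1) (N Z)).
  by rewrite (cyc3 (N Z) (N T1) (N T2)); lra.
pose v := \sum_a N (f a) (f a).
have Nv Z : Z \in lker Q -> N Z v = \sum_a N (f a) (N (f a) Z).
  move=> Zb; have lieb a : [< Z, f a >] \in lker Q by rewrite NT memvB ?bN.
  (* The tensor sum of f_a (x) f_a is invariant under the bracket with Z: its
     variation has the coefficients B [Z, f_a] f_b, skew in a and b. *)
  have s0 : \sum_a (N (f a) [< Z, f a >] + N [< Z, f a >] (f a)) = 0.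
    under eq_bigr => a _.
      rewrite {1 2}[[< Z, f a >]](fF _ (lieb a)) !linear_sum sum_lfunE -big_split /=.
      under eq_bigr do rewrite !linearZ scale_lfunE /= -scalerDr.
      over.
    under eq_bigr do under eq_bigr do rewrite scalerDr.
    under eq_bigr do rewrite big_split /=.
    rewrite big_split /= [X in _ + X]exchange_big -big_split big1 //= => a _.
    rewrite -big_split big1 //= => b _.
    by rewrite (Binv Z (f b)) scaleNr subrr.
  transitivity (\sum_a N (f a) (N (f a) Z) +
    \sum_a (N (f a) [< Z, f a >] + N [< Z, f a >] (f a))); last by rewrite s0 addr0.
  rewrite linear_sum -big_split; apply: eq_bigr => a _ /=.
  rewrite Nlie NT linearB !(add_lfunE, opp_lfunE, comp_lfunE) /=.
  by rewrite addrA (addrC (N _ (N _ Z))) subrK [RHS]addrC subrK.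
(* The trace of X |-> N X v, computed on both sides of Nv. *)
have NfP a i : N (f a) (e i - Q (e i)) = 0.
  have t0 : \sum_j \sum_b g (N (f b) (e j - Q (e j))) (N (f b) (e j - Q (e j))) = 0.
    transitivity (g v (\sum_i N (e i) (e i))); last by rewrite N0 dot0r.
    rewrite dotsumr; apply: eq_bigr => j _.
    apply: oppr_inj; rewrite -NK -(NP (e j)) (Nv _ (PQ _)) dotsuml -sumrN.
    apply: eq_bigr => b _; rewrite [RHS]gP; last by do 2!apply: (bN).
    by rewrite [RHS]NK.
  apply: (@dot_eq0 _ _ g); move: a isT; apply: psumr_eq0P => [a _|].
    exact: dot_ge0.
  move: i isT; apply: psumr_eq0P => // i _; apply: sumr_ge0 => b _; exact: dot_ge0.
have NP0 Z T : N (Z - Q Z) (T - Q T) = 0.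
  rewrite [Z - Q Z](fF _ (PQ Z)) linear_sum sum_lfunE; apply: big1 => a _.
  rewrite linearZ scale_lfunE /= [T]eF linear_sum -sumrB linear_sum.
  rewrite big1 ?scaler0 // => i _.
  by rewrite linearZ /= -scalerBr linearZ /= NfP scaler0.
by rewrite Nlie -(NP X) -(NP Y) -Nlie NT !NP0 subrr linear0.
Qed.

End Flat.

(** * Unimodular Kaehler Lie algebras are metabelian *)

Lemma unimodular_div0 {R : rcfType} {L : lieAlgType R} (g : {dot L for idfun})
    (N : 'Hom(L, 'End(L))) m (e : 'I_m -> L) :
  unimodular L -> levi_civita g N -> frame g e -> \sum_i N (e i) (e i) = 0.
Proof.
move=> uni [NK NT] eF; apply: (@dot_inj _ _ g) => Z; rewrite dot0l dotsuml.
rewrite -[RHS](uni Z) (lfun_trace_frame eF); apply: eq_bigr => i _.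
have Z0 := NK Z (e i) (e i); rewrite (dotC g (e i)) in Z0.
rewrite adE NT NK !dotE !(dotC g (e i)); lra.
Qed.

Theorem kahler_unimodular_metabelian {R : rcfType} {L : lieAlgType R}
    (g : {dot L for idfun}) (J : 'End(L)) :
  kahler g J -> unimodular L ->
  forall X Y Z W : L, [< [< X, Y >], [< Z, W >] >] = 0.
Proof.
move=> gJ uni X Y Z W; have [N NLC] := levi_civita_exists g.
have [m [e [_ eF']]] := orthonormal_frame g fullv.
have eF : frame g e by move=> T; apply: eF'; apply: memvf.
have N0 := unimodular_div0 uni NLC eF.
have Nl := flat_lie NLC eF N0 (kahler_flat gJ NLC eF N0).
by case: NLC => _ ->; rewrite !Nl !lfunE subrr.
Qed.

(** * From integrable LCK to Kaehler Lie algebras *)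

Definition lieAlg_of {F : fieldType} (V : vectType F)
    (br : Vector_isLieAlgebra F V) :
  lieAlgType F := HB.pack (Vector.sort V) br.

Section Lck.
Context {R : realType} {L : lieAlgType R} (S : lck_structure L).
Hypothesis integrableS : lck_integrable S.
Implicit Types X Y Z : L.

Local Notation g := (lck_g S).
Local Notation J := (lck_J S).
Local Notation theta := (lck_theta S).
Local Notation eta := (lck_eta S).

(* A is the Lee vector field, and B = J A the vector dual to eta. *)
Let A := sharp g theta.
Let B := J A.

Let JJ X : J (J X) = - X.
Proof. by rewrite -comp_lfunE lck_J2 opp_lfunE id_lfunE. Qed.

Let thetaE X : theta X = g A X. Proof. by rewrite sharpP. Qed.
Let etaE X : eta X = - theta (J X). Proof. exact: lck_etaE. Qed.
Let thetaJ X : theta (J X) = - eta X. Proof. by rewrite etaE opprK. Qed.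
Let etaJ X : eta (J X) = theta X. Proof. by rewrite etaE JJ linearN opprK. Qed.

Let JK : skewadj g J.
Proof.
move=> X Y; rewrite dotC; apply/eqP; rewrite -addr_eq0 addrC; apply/eqP.
have O Z : g Z (J Z) = 0 := lck_Omega_alt S Z.
by have := O (X + Y); rewrite linearD !dotE !O addr0 add0r.
Qed.

Let thetaA : theta A = 1.
Proof.
rewrite thetaE; have := lck_theta_norm S.
rewrite /conorm -/A => /(congr1 (fun x => x ^+ 2)).
by rewrite sqr_sqrtr ?dot_ge0 // expr1n.
Qed.
Let etaB : eta B = 1. Proof. by rewrite etaJ thetaA. Qed.
Let etaA : eta A = 0.
Proof. by rewrite etaE thetaE -[g A _]/(lck_Omega S A A) lck_Omega_alt oppr0. Qed.
Let thetaB : theta B = 0. Proof. by rewrite thetaJ etaA oppr0. Qed.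
Let gB X : g B X = eta X. Proof. by rewrite JK -thetaE etaE. Qed.

Definition lck_ker : {vspace L} := (lker theta :&: lker eta)%VS.
Local Notation h := lck_ker.

Let hP X : reflect (theta X = 0 /\ eta X = 0) (X \in h).
Proof.
rewrite memv_cap !memv_ker; apply: (iffP andP) => [[/eqP ? /eqP ?]|[-> ->]] //.
Qed.

Let theta_lie X Y : theta [< X, Y >] = 0.
Proof. by apply/eqP; rewrite -oppr_eq0; apply/eqP/(lck_dtheta S). Qed.

(* Integrability evaluated on (B, X, Y). *)
Let eta_lie X Y : eta X = 0 -> eta Y = 0 -> eta [< X, Y >] = 0.
Proof.
move=> X0 Y0; have := integrableS B X Y; rewrite /wedge12 /d1 etaB X0 Y0.
by rewrite mul1r !mul0r !addr0 => /eqP; rewrite oppr_eq0 => /eqP.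
Qed.

(* The Nijenhuis condition on A and X, seen by theta, turns eta [B, X] into
   - eta [A, J X], where both arguments are in the kernel of eta. *)
Let eta_lieB X : X \in h -> eta [< B, X >] = 0.
Proof.
move=> /hP[X0 Y0]; have := congr1 theta (lck_JN S A X).
rewrite /nijenhuis !linearB /= !theta_lie !thetaJ linear0 -/B.
rewrite (@eta_lie A (J X)) // ?etaJ //.
by rewrite linear0 !opprK !addr0 add0r subr0 linear0.
Qed.

Let lckP_exists : exists P : 'End(L), forall X, P X = X - theta X *: A - eta X *: B.
Proof.
apply: linear_lfun => a X Y; rewrite !linPE !scalerDl !scale_regular -!scalerA.
by rewrite !opprD (addrACA (a *: X)) (addrACA (_ + _)) !scalerBr.
Qed.

Lemma lck_ker_decomp X : exists2 Y, Y \in h & X = Y + theta X *: A + eta X *: B.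
Proof.
exists (X - theta X *: A - eta X *: B).
  apply/hP; rewrite !linearB !linearZ /= thetaA thetaB etaA etaB.
  by rewrite !scale_regular !oppr0 !mulrN1 !mulr0 !addr0 !subrr.
by rewrite addrAC !subrK.
Qed.

(** This is where integrability is combined with the integrability of J: the
    former makes the kernel of eta a subalgebra, and the latter takes care of
    the bracket with B. *)
Lemma lck_ker_ideal X Y : X \in h -> [< X, Y >] \in h.
Proof.
move=> Xh; apply/hP; rewrite theta_lie; split=> //.
have [Z Zh ->] := lck_ker_decomp Y.
rewrite !linearDr /= !linearZ /= !linearD !linearZ /=.
have [[_ X0] [_ Z0]] := (hP _ Xh, hP _ Zh).
by rewrite (eta_lie X0 Z0) (eta_lie X0 etaA) (lieC B) (linearN eta) /=
  (eta_lieB Xh) oppr0 !scaler0 !addr0.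
Qed.

Lemma lck_ker_dOmega X Y Z : X \in h -> Y \in h -> Z \in h ->
  d2 (lck_Omega S) X Y Z = 0.
Proof.
move=> /hP[X0 _] /hP[Y0 _] /hP[Z0 _].
by rewrite lck_dOmega /wedge12 X0 Y0 Z0 !mul0r !addr0.
Qed.

Hypothesis uni : unimodular L.

(** The subalgebra h of theta = eta = 0 is Kaehler, and it is unimodular because
    as an ideal it carries the whole trace of ad X for X in h.  To stay on the
    space L, h is replaced by its product with an abelian algebra of
    dimension two, that is by the bracket [P X, P Y] where P is the orthogonal
    projection onto h. *)
Lemma lck_ker_metabelian X Y Z W : X \in h -> Y \in h -> Z \in h -> W \in h ->
  [< [< X, Y >], [< Z, W >] >] = 0.
Proof.
have [P PE] := lckP_exists.
have Ph T : P T \in h.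
  by have [T' T'h TE] := lck_ker_decomp T; rewrite PE {1}TE addrAC addrK addrK.
have Pid T : T \in h -> P T = T.
  by move=> /hP[T0 T0']; rewrite PE T0 T0' !scale0r !subr0.
have PJ T : P (J T) = J (P T).
  have JB : J B = - A by apply: JJ.
  have JZ a Z' : J (a *: Z') = a *: J Z' by apply: linearZ.
  by rewrite !PE !(linearB J) /= !JZ JB thetaJ etaJ scaleNr scalerN !opprK addrAC.
have Pg T T' : g (P T) T' = g T (P T').
  rewrite !PE !dotE !dotZl !dotZr (dotC g T A) (dotC g T B) -!thetaE !gB; lra.
have Pl T T' : P [< P T, T' >] = [< P T, T' >] by rewrite Pid ?lck_ker_ideal.
have [br brE] : exists br : Vector_isLieAlgebra R L,
    forall T T' : lieAlg_of br, [< T, T' >] = [< P T, P T' >] :> L.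
  unshelve eexists (@Vector_isLieAlgebra.Build R L
    (fun T T' => [< P T, P T' >]) _ _ _ _).
  - by move=> T' a T1 T2; rewrite !linPE.
  - by move=> T' a T1 T2; rewrite !linPE.
  - by move=> T; apply: liexx.
  - by move=> T1 T2 T3; rewrite /= !Pl lie_jacobi.
  by [].
pose K := lieAlg_of br.
have gJ : @kahler R K g J.
  split.
  - exact: JK.
  - exact: (lck_J2 S).
  - move=> T T'; rewrite /nijenhuis !brE !PJ; exact: (lck_JN S).
  - move=> T1 T2 T3; rewrite /d2 !brE.
    have E T T' T'' : g [< P T, P T' >] (J T'') = lck_Omega S [< P T, P T' >] (P T'').
      by rewrite /lck_Omega -PJ -Pg Pl.
    by rewrite !E; apply: lck_ker_dOmega.
have uniK : unimodular K.
  move=> T; have [m [e [_ eF']]] := orthonormal_frame g fullv.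
  have eF : frame g e by move=> Z'; apply: eF'; apply: memvf.
  have adK : ad (T : K) = (ad (P T : L) \o P)%VF :> 'End(L).
    by apply/lfunP => T'; rewrite comp_lfunE [RHS]adE -brE; apply: (@adE R K).
  have PadP : (P \o ad (P T))%VF = ad (P T).
    by apply/lfunP => T'; rewrite comp_lfunE !adE Pl.
  rewrite -(uni (P T)) -[in RHS]PadP (lfun_trace_frame eF) -(traceC eF).
  rewrite -adK; exact: (@lfun_trace_frame R K g _ _ eF).
move=> Xh Yh Zh Wh.
have := kahler_unimodular_metabelian gJ uniK X Y Z W.
by rewrite !brE !Pl !Pid.
Qed.

Lemma lck_lie_ker_theta X Y : theta X = 0 -> theta Y = 0 -> [< X, Y >] \in h.
Proof.
move=> X0 Y0.
have [X' X'h ->] := lck_ker_decomp X; have [Y' Y'h ->] := lck_ker_decomp Y.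
rewrite X0 Y0 !scale0r !addr0 linearDl /= memvD ?(lck_ker_ideal _ X'h) //.
rewrite linearZl_LR /= memvZ // linearDr /= linearZr_LR /= liexx scaler0 addr0.
by rewrite lieC memvN lck_ker_ideal.
Qed.

(** The derived series falls into the kernel of theta, then into h, where two
    more steps suffice. *)
Lemma lck_solvable : lie_solvable L.
Proof.
have D1 : (derived_series 1 <= lker theta)%VS.
  by apply/lie_spaceP => X Y _ _; rewrite memv_ker theta_lie.
have D2 : (derived_series 2 <= h)%VS.
  apply/lie_spaceP => X Y /(subvP D1) Xt /(subvP D1) Yt.
  by apply: lck_lie_ker_theta; apply/eqP; rewrite -memv_ker.
have D3 : (derived_series 3 <= lie_space h h)%VS.
  by apply/lie_spaceP => X Y /(subvP D2) Xh /(subvP D2) Yh; apply: memv_lie.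
exists 4; apply/eqP; rewrite -subv0.
apply/lie_spaceP => X Y /(subvP D3) Xh /(subvP D3) Yh; rewrite memv0.
(* A vector that commutes with all brackets of h commutes with their span. *)
have sub Z : (forall U V, U \in h -> V \in h -> [< Z, [< U, V >] >] = 0) ->
    (lie_space h h <= lker (ad Z))%VS.
  by move=> Z0; apply/lie_spaceP => U V Uh Vh; rewrite memv_ker adE Z0.
rewrite -adE -memv_ker; apply: subvP Yh; apply: (sub _) => U V Uh Vh.
apply/eqP; rewrite lieC oppr_eq0 -adE -memv_ker; apply: subvP Xh.
by apply: (sub _) => Z W Zh Wh; apply: lck_ker_metabelian.
Qed.

End Lck.

Theorem theorem4p3 (R : realType) (g : lieAlgType R) (n : nat)
    (hn : (1 <= n)%N) (hdim : \dim {:g} = (2 * n + 2)%N)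
    (S : lck_structure g) (hunim : unimodular g) (hint : lck_integrable S) :
  lie_solvable g.
Proof. exact: lck_solvable hint hunim. Qed.
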